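(* Let $(D,E,i,j,k)$ be an exact couple of abelian groups. The following assertions hold: (1) If $(D,E,i,j,k)$ has up to $i^r$-torsion for some $r\geq 1$, then the associated spectral sequence degenerates at the $(r+1)$st page, i.e. there is a canonical isomorphism $\phi_r:E_{r+1}\to E_\infty$. Further, there is an exact sequence $$0\longrightarrow D_1\cap \ker(i^{\infty})\longrightarrow D\xrightarrow{(j,p)} \ker(k)\oplus\overline{D}\longrightarrow E_{r+1}\longrightarrow 0,$$ where the last map is the difference of the projection $\ker(k)\to\ker(k)/j(\ker(i^\infty))$ and of $\overline{j}:\overline D\to\ker(k)/j(\ker(i^\infty))$, followed by the canonical isomorphism $\ker(k)/j(\ker(i^\infty))\cong E_\infty\cong E_{r+1}$. (2) If $(D,E,i,j,k)$ has up to $i$-torsion, this exact sequence induces a Cartesian square with corners $D$, $\ker(k)$, $\overline D$, $E_2$, with maps $j:D\to\ker(k)$, $p:D\to\overline D$, $\ker(k)\to E_2$ and $\overline D\to E_2$; that is, $D\cong\ker(k)\times_{E_2}\overline D$ via $(j,p)$. (3) Let $r\ge 1$. If $\ker\big((j,p):D\to\ker(k)\oplus\overline D\big)=D_1\cap \ker(i^{r-1})$, then $(D,E,i,j,k)$ has up to $i^r$-torsion.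
   Context: An exact couple $(D,E,i,j,k)$ consists of abelian groups $D,E$ and homomorphisms $i:D\to D$, $j:D\to E$, $k:E\to D$ such that $\cdots\xrightarrow{k}D\xrightarrow{i}D\xrightarrow{j}E\xrightarrow{k}D\xrightarrow{i}\cdots$ is exact. For $n\ge1$: $D_n:=\mathrm{Im}(i^n)$, $Z_n:=k^{-1}(\mathrm{Im}(i^n))$, $B_n:=j(\ker(i^n))$, $E_{n+1}:=Z_n/B_n$, and $E_1:=E$; these are the pages of the associated spectral sequence. $\ker(i^\infty):=\bigcup_n\ker(i^n)$, and $E_\infty:=\bigcap_nZ_n/\bigcup_nB_n$, where $\bigcup_nB_n=j(\ker(i^\infty))$. $D[i^{-1}]:=\varinjlim(D\xrightarrow{i}D\xrightarrow{i}\cdots)$, $p:D\to D[i^{-1}]$ is the canonical map, and $\overline D:=\mathrm{Im}(p)\cong D/\ker(i^\infty)$. The map $\overline j:\overline D\to\ker(k)/j(\ker(i^\infty))$ is induced by $j$. The exact couple has up to $i^r$-torsion if $\ker(i^{r+1})=\ker(i^r)$; ''up to $i$-torsion'' means the case $r=1$. Here $i^0=\mathrm{id}$. *)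

(* Defs.v *)
From HB Require Import structures.
From mathcomp Require Import all_boot all_order all_algebra.
From mathcomp Require Import boolp zify.

Set Implicit Arguments.
Unset Strict Implicit.
Unset Printing Implicit Defensive.

Import GRing.Theory.

Local Open Scope ring_scope.
Local Open Scope quotient_scope.

Section Subgroups.
Variables (U V : zmodType).

Definition kerg (f : {additive U -> V}) : {pred U} := [pred x | f x == 0].

Definition img (f : {additive U -> V}) : {pred V} :=
  [pred y | `[< exists x, f x = y >]].

Definition preimg (f : {additive U -> V}) (A : {pred V}) : {pred U} :=
  [pred x | f x \in A].

Definition imgof (f : {additive U -> V}) (A : {pred U}) : {pred V} :=
  [pred y | `[< exists2 x, x \in A & f x = y >]].

Lemma kerg_closed f : zmod_closed (kerg f).
Proof.
by split=> [|x y]; rewrite !inE ?raddf0 // => /eqP fx /eqP fy;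
   rewrite raddfB fx fy subrr.
Qed.
HB.instance Definition _ f := GRing.isZmodClosed.Build U (kerg f) (kerg_closed f).

Lemma img_closed f : zmod_closed (img f).
Proof.
split=> [|x y]; first by apply/asboolP; exists 0; rewrite raddf0.
move=> /asboolP[a <-] /asboolP[b <-].
by apply/asboolP; exists (a - b); rewrite raddfB.
Qed.
HB.instance Definition _ f := GRing.isZmodClosed.Build V (img f) (img_closed f).

Lemma preimg_closed f (A : zmodClosed V) : zmod_closed (preimg f A).
Proof.
split=> [|x y]; first by rewrite inE raddf0 rpred0.
by rewrite !inE raddfB => fx fy; rewrite rpredB.
Qed.
HB.instance Definition _ f (A : zmodClosed V) :=
  GRing.isZmodClosed.Build U (preimg f A) (preimg_closed f A).

Lemma imgof_closed f (A : zmodClosed U) : zmod_closed (imgof f A).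
Proof.
split=> [|x y]; first by apply/asboolP; exists 0; rewrite ?raddf0 ?rpred0.
move=> /asboolP[a Aa <-] /asboolP[b Ab <-].
by apply/asboolP; exists (a - b); rewrite ?raddfB ?rpredB.
Qed.
HB.instance Definition _ f (A : zmodClosed U) :=
  GRing.isZmodClosed.Build V (imgof f A) (imgof_closed f A).

End Subgroups.

Section CapSubgroup.
Variables (V : zmodType) (A B : zmodClosed V).

Definition capg : {pred V} := [predI A & B].

Lemma capg_closed : zmod_closed capg.
Proof.
split=> [|x y]; first by rewrite inE /= !rpred0.
by rewrite !inE => /andP[Ax Bx] /andP[Ay By]; rewrite !rpredB.
Qed.
HB.instance Definition _ := GRing.isZmodClosed.Build V capg capg_closed.

End CapSubgroup.

Definition exact_at (U V W : zmodType) (f : U -> V) (g : V -> W) : Prop :=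
  forall y, g y = 0 <-> exists x, f x = y.

Section SubgroupType.
Variables (V : zmodType) (A : zmodClosed V).

Definition subg := {x : V | x \in A}.
HB.instance Definition _ := SubChoice.on subg.
HB.instance Definition _ := [SubChoice_isSubZmodule of subg by <:].

Definition subg_val : {additive subg -> V} := \val.

End SubgroupType.

Section Corestriction.
Variables (U V : zmodType) (A : zmodClosed V) (f : {additive U -> V}).
Hypothesis fA : forall x, f x \in A.

Definition corestr_fun (x : U) : subg A := exist _ (f x) (fA x).

Lemma corestr_zmod : zmod_morphism corestr_fun.
Proof. by move=> x y; apply: val_inj; rewrite raddfB /= raddfB. Qed.
HB.instance Definition _ :=
  GRing.isZmodMorphism.Build U (subg A) corestr_fun corestr_zmod.

Definition corestr : {additive U -> subg A} := corestr_fun.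

End Corestriction.

(* A/B, as the quotient of the group A by the trace of B on A; B need not be
   contained in A for this to be defined, but it is in every use below. *)
Section Subquotient.
Variables (V : zmodType) (A B : zmodClosed V).

Definition subquot : zmodType := Quotient.quot (preimg (subg_val A) B).

Definition subquot_pi : {additive subg A -> subquot} :=
  \pi_(Quotient.quot (preimg (subg_val A) B)).

Lemma subquot_piP (x y : subg A) :
  subquot_pi x = subquot_pi y <-> val x - val y \in B.
Proof.
rewrite -(raddfB (subg_val A) x y) -[_ \in B]/(x - y \in preimg (subg_val A) B).
by rewrite Quotient.idealrBE; split=> [->|/eqP].
Qed.

Lemma subquot_pi_surj (q : subquot) : exists x, subquot_pi x = q.
Proof. by exists (repr q); rewrite /subquot_pi /= reprK. Qed.

End Subquotient.

Section SubquotientMap.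
Variables (V : zmodType) (A A' B B' : zmodClosed V).
Hypotheses (sA : {subset A <= A'}) (sB : {subset B <= B'}).

Definition subquot_map_fun (q : subquot A B) : subquot A' B' :=
  subquot_pi A' B' (corestr (f := subg_val A) (fun x => sA (valP x)) (repr q)).

Lemma subquot_map_funE (x : subg A) :
  subquot_map_fun (subquot_pi A B x) =
  subquot_pi A' B' (corestr (f := subg_val A) (fun x => sA (valP x)) x).
Proof.
apply/subquot_piP => /=; apply: sB; apply/subquot_piP.
by rewrite /subquot_pi /= reprK.
Qed.

Lemma subquot_map_zmod : zmod_morphism subquot_map_fun.
Proof.
move=> q r; have [x <-] := subquot_pi_surj q; have [y <-] := subquot_pi_surj r.
by rewrite -raddfB !subquot_map_funE -!raddfB.
Qed.
HB.instance Definition _ :=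
  GRing.isZmodMorphism.Build (subquot A B) (subquot A' B')
    subquot_map_fun subquot_map_zmod.

(* The homomorphism A/B -> A'/B' induced by the inclusions A <= A', B <= B'. *)
Definition subquot_map : {additive subquot A B -> subquot A' B'} :=
  subquot_map_fun.

Lemma subquot_mapE (x : subg A) :
  subquot_map (subquot_pi A B x) =
  subquot_pi A' B' (corestr (f := subg_val A) (fun x => sA (valP x)) x).
Proof. exact: subquot_map_funE. Qed.

End SubquotientMap.

Section FibreProduct.
Variables (U V W : zmodType) (u : {additive U -> W}) (v : {additive V -> W}).

Definition fibre_prod_pred : {pred U * V} := [pred x | u x.1 == v x.2].

Lemma fibre_prod_closed : zmod_closed fibre_prod_pred.
Proof.
split=> [|x y]; first by rewrite inE /= !raddf0.
by rewrite !inE /= !raddfB => /eqP-> /eqP->.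
Qed.
HB.instance Definition _ :=
  GRing.isZmodClosed.Build (U * V)%type fibre_prod_pred fibre_prod_closed.

Definition fibre_prod := subg fibre_prod_pred.
HB.instance Definition _ := GRing.Zmodule.on fibre_prod.

End FibreProduct.

Definition cartesian (X U V W : zmodType)
    (f : {additive X -> U}) (g : {additive X -> V})
    (u : {additive U -> W}) (v : {additive V -> W}) : Prop :=
  (forall x, u (f x) = v (g x)) /\
  forall (T : zmodType) (a : {additive T -> U}) (b : {additive T -> V}),
    (forall t, u (a t) = v (b t)) ->
    (exists h : {additive T -> X},
        (forall t, f (h t) = a t) /\ (forall t, g (h t) = b t)) /\
    (forall h h' : {additive T -> X},
        (forall t, f (h t) = a t /\ g (h t) = b t) ->
        (forall t, f (h' t) = a t /\ g (h' t) = b t) -> h =1 h').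

Section Iterate.
Variables (M : zmodType) (f : {additive M -> M}) (n : nat).

Definition iterg_fun : M -> M := iter n f.

Lemma iterg_zmod : zmod_morphism iterg_fun.
Proof.
by rewrite /iterg_fun => x y; elim: n => //= m ->; rewrite raddfB.
Qed.
HB.instance Definition _ := GRing.isZmodMorphism.Build M M iterg_fun iterg_zmod.

Definition iterg : {additive M -> M} := iterg_fun.

End Iterate.

Section KerInf.
Variables (M : zmodType) (f : {additive M -> M}).

Definition ker_inf : {pred M} := [pred x | `[< exists n, x \in kerg (iterg f n) >]].

Lemma iterg_add m n x : iterg f (m + n) x = iterg f m (iterg f n x).
Proof. exact: iterD. Qed.

Lemma ker_inf_closed : zmod_closed ker_inf.
Proof.
split=> [|x y]; first by apply/asboolP; exists 0%N; rewrite rpred0.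
move=> /asboolP[m /eqP mx] /asboolP[n /eqP ny].
apply/asboolP; exists (m + n)%N; apply/eqP.
have mnx : iterg f (m + n) x = 0 by rewrite addnC iterg_add mx raddf0.
have mny : iterg f (m + n) y = 0 by rewrite iterg_add ny raddf0.
by rewrite raddfB mnx mny subrr.
Qed.
HB.instance Definition _ := GRing.isZmodClosed.Build M ker_inf ker_inf_closed.

End KerInf.

(* The direct limit of M -f-> M -f-> ... : the pair (m, x) stands for the
   element x of the m-th copy of M.  Two pairs (m, x) and (n, y) are identified
   when their images in some later copy, numbered N + m + n, agree. *)
Section Telescope.
Variables (M : zmodType) (f : {additive M -> M}).

Definition tel_pre : choiceType := (nat * M)%type.

Definition tel_rel (a b : tel_pre) : bool :=
  `[< exists N, iterg f (N + b.1) a.2 = iterg f (N + a.1) b.2 >].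

Lemma tel_rel_equiv : equiv_class_of tel_rel.
Proof.
split=> [a|a b|b a c].
- by apply/asboolP; exists 0%N.
- by apply/asboolP/asboolP => -[N e]; exists N.
- move=> /asboolP[N e] /asboolP[P e']; apply/asboolP; exists (N + P + b.1)%N.
  have -> : (N + P + b.1 + c.1 = (P + c.1) + (N + b.1))%N by lia.
  rewrite iterg_add e -iterg_add.
  have -> : (P + c.1 + (N + a.1) = (N + a.1) + (P + c.1))%N by lia.
  rewrite iterg_add e' -iterg_add; congr (iterg f _ _); lia.
Qed.

Canonical tel_equiv := EquivRelPack tel_rel_equiv.
Canonical tel_encModRel := defaultEncModRel tel_rel.

Definition telescope := {eq_quot tel_rel}.
HB.instance Definition _ := EqQuotient.on telescope.
HB.instance Definition _ := Choice.on telescope.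

Definition tel_in (n : nat) (x : M) : telescope := \pi_telescope (n, x).

Lemma tel_inP m n x y :
  tel_in m x = tel_in n y <->
  exists N, iterg f (N + n) x = iterg f (N + m) y.
Proof.
rewrite /tel_in; split=> [/eqmodP /asboolP //|e].
by apply/eqmodP/asboolP.
Qed.

Lemma tel_in_surj q : exists n x, tel_in n x = q.
Proof. by exists (repr q).1, (repr q).2; rewrite /tel_in -surjective_pairing reprK. Qed.

Lemma tel_in_shift m n x : tel_in (m + n) (iterg f n x) = tel_in m x.
Proof.
apply/tel_inP; exists 0%N; rewrite -iterg_add !add0n //.
Qed.

Definition tel_zero : telescope := tel_in 0 0.

Definition tel_opp (q : telescope) : telescope :=
  tel_in (repr q).1 (- (repr q).2).

Definition tel_add (q r : telescope) : telescope :=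
  tel_in ((repr q).1 + (repr r).1)
         (iterg f (repr r).1 (repr q).2 + iterg f (repr q).1 (repr r).2).

Lemma tel_in_repr (m : nat) (x : M) : exists N,
  iterg f (N + m) (repr (tel_in m x)).2 = iterg f (N + (repr (tel_in m x)).1) x.
Proof.
by apply/tel_inP; rewrite /tel_in -surjective_pairing reprK.
Qed.

Lemma tel_oppE m x : tel_opp (tel_in m x) = tel_in m (- x).
Proof.
have [N e] := tel_in_repr m x.
by apply/tel_inP; exists N; rewrite !raddfN e.
Qed.

Lemma tel_addE m n x y :
  tel_add (tel_in m x) (tel_in n y) = tel_in (m + n) (iterg f n x + iterg f m y).
Proof.
have [N e] := tel_in_repr m x; have [P e'] := tel_in_repr n y.
rewrite /tel_add; apply/tel_inP; exists (N + P)%N.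
set a := (repr _).1 in e *; set b := (repr _).1 in e' *.
rewrite !raddfD -!iterg_add; congr (_ + _).
- have -> : (N + P + (m + n) + b = (P + n + b) + (N + m))%N by lia.
  by rewrite iterg_add e -iterg_add; congr (iterg f _ _); lia.
- have -> : (N + P + (m + n) + a = (N + m + a) + (P + n))%N by lia.
  by rewrite iterg_add e' -iterg_add; congr (iterg f _ _); lia.
Qed.

Lemma tel_addA : associative tel_add.
Proof.
move=> q r s; have [m [x <-]] := tel_in_surj q; have [n [y <-]] := tel_in_surj r.
have [l [z <-]] := tel_in_surj s; rewrite !tel_addE addnA; congr tel_in.
by rewrite !raddfD -!iterg_add addrA [(n + l)%N]addnC [(l + m)%N]addnC.
Qed.

Lemma tel_addC : commutative tel_add.
Proof.
move=> q r; have [m [x <-]] := tel_in_surj q; have [n [y <-]] := tel_in_surj r.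
by rewrite !tel_addE addnC addrC.
Qed.

Lemma tel_add0 : left_id tel_zero tel_add.
Proof.
by move=> q; have [m [x <-]] := tel_in_surj q; rewrite tel_addE raddf0 add0r.
Qed.

Lemma tel_addN : left_inverse tel_zero tel_opp tel_add.
Proof.
move=> q; have [m [x <-]] := tel_in_surj q; rewrite tel_oppE tel_addE.
by rewrite raddfN addNr; apply/tel_inP; exists 0%N; rewrite !raddf0.
Qed.

HB.instance Definition _ :=
  GRing.isZmodule.Build telescope tel_addA tel_addC tel_add0 tel_addN.

Lemma tel_in0_zmod : zmod_morphism (tel_in 0).
Proof. by move=> x y; rewrite -[RHS]/(tel_add _ (tel_opp _)) tel_oppE tel_addE. Qed.
HB.instance Definition _ :=
  GRing.isZmodMorphism.Build M telescope (tel_in 0) tel_in0_zmod.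

Definition tel_can : {additive M -> telescope} := tel_in 0.

End Telescope.

Record exact_couple := ExactCouple {
  ecD : zmodType;
  ecE : zmodType;
  eci : {additive ecD -> ecD};
  ecj : {additive ecD -> ecE};
  eck : {additive ecE -> ecD};
  ec_exact_ij : exact_at eci ecj;
  ec_exact_jk : exact_at ecj eck;
  ec_exact_ki : exact_at eck eci
}.

Section ExactCouple.
Variable C : exact_couple.
Local Notation D := (ecD C).
Local Notation E := (ecE C).
Local Notation i := (eci C).
Local Notation j := (ecj C).
Local Notation k := (eck C).

Definition ecDn (n : nat) : zmodClosed D := img (iterg i n).
Definition ecZ (n : nat) : zmodClosed E := preimg k (ecDn n).
Definition ecB (n : nat) : zmodClosed E := imgof j (kerg (iterg i n)).

(* The page numbered n + 1, for 0 < n. *)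
Definition page_succ (n : nat) : zmodType := subquot (ecZ n) (ecB n).

Definition ecZinf : {pred E} := [pred x | `[< forall n, (0 < n)%N -> x \in ecZ n >]].

Lemma ecZinf_closed : zmod_closed ecZinf.
Proof.
split=> [|x y]; first by apply/asboolP => n _; rewrite rpred0.
by move=> /asboolP Zx /asboolP Zy; apply/asboolP => n n0;
   rewrite rpredB ?Zx ?Zy.
Qed.
HB.instance Definition _ := GRing.isZmodClosed.Build E ecZinf ecZinf_closed.

Definition ecBinf : {pred E} :=
  [pred x | `[< exists2 n, (0 < n)%N & x \in ecB n >]].

Lemma ecB_mono m n : {subset ecB m <= ecB (n + m)}.
Proof.
move=> x /asboolP[y /eqP my <-]; apply/asboolP; exists y => //.
by rewrite inE iterg_add my raddf0.
Qed.

Lemma ecBinf_closed : zmod_closed ecBinf.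
Proof.
split=> [|x y]; first by apply/asboolP; exists 1%N; rewrite ?rpred0.
move=> /asboolP[m m0 Bx] /asboolP[n n0 By]; apply/asboolP.
exists (m + n)%N; first by rewrite addn_gt0 m0.
by rewrite rpredB ?(ecB_mono m By) // addnC (ecB_mono n Bx).
Qed.
HB.instance Definition _ := GRing.isZmodClosed.Build E ecBinf ecBinf_closed.

Definition page_inf : zmodType := subquot ecZinf ecBinf.

Definition kerk : zmodType := subg (kerg k).

Definition jkerinf : zmodClosed E := imgof j (ker_inf i).

Definition kerk_quot : zmodType := subquot (kerg k) jkerinf.

Definition kerk_pi : {additive kerk -> kerk_quot} := subquot_pi (kerg k) jkerinf.

Lemma kerk_subZinf : {subset kerg k <= ecZinf}.
Proof.
move=> x /eqP kx; apply/asboolP => n _; apply/asboolP; exists 0.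
by rewrite raddf0 kx.
Qed.

Lemma jkerinf_subBinf : {subset jkerinf <= ecBinf}.
Proof.
move=> x /asboolP[y /asboolP[n ny] <-]; apply/asboolP; exists (1 + n)%N => //.
by apply: ecB_mono; apply/asboolP; exists y.
Qed.

(* Induced by the inclusion of ker k in the intersection of the Z_n. *)
Definition kerk_quot_to_inf : {additive kerk_quot -> page_inf} :=
  subquot_map kerk_subZinf jkerinf_subBinf.

(* D[i^-1] and its canonical map p. *)
Definition ecDloc : zmodType := telescope i.
Definition ecp : {additive D -> ecDloc} := tel_can i.

Definition Dbar : zmodType := subg (img ecp).

Lemma ecp_img x : ecp x \in img ecp.
Proof. by apply/asboolP; exists x. Qed.

Definition pbar : {additive D -> Dbar} := corestr ecp_img.

Lemma ecj_kerk x : j x \in kerg k.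
Proof. by apply/eqP; have [_ ->] := @ec_exact_jk C (j x); last by exists x. Qed.

Definition j_kerk : {additive D -> kerk} := corestr ecj_kerk.

Lemma pbar_surj (b : Dbar) : {d : D | pbar d = b}.
Proof.
by apply: cid; have /asboolP[d db] := valP b; exists d; apply: val_inj.
Qed.

(* The value at p d is the class of j d; this does not depend on d, by jbarE. *)
Definition jbar_fun (b : Dbar) : kerk_quot := kerk_pi (j_kerk (sval (pbar_surj b))).

Lemma jbarE d : jbar_fun (pbar d) = kerk_pi (j_kerk d).
Proof.
rewrite /jbar_fun; case: (pbar_surj _) => d' /= /(congr1 val) /= e.
apply/subquot_piP => /=; rewrite -raddfB; apply/asboolP; exists (d' - d) => //.
have /tel_inP[N] := e; rewrite addn0 => eN.
by apply/asboolP; exists N; apply/eqP; rewrite raddfB eN subrr.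
Qed.

Lemma jbar_zmod : zmod_morphism jbar_fun.
Proof.
move=> a b; have [x <-] := pbar_surj a; have [y <-] := pbar_surj b.
by rewrite -raddfB !jbarE -!raddfB.
Qed.
HB.instance Definition _ :=
  GRing.isZmodMorphism.Build Dbar kerk_quot jbar_fun jbar_zmod.

Definition jbar : {additive Dbar -> kerk_quot} := jbar_fun.

Definition jp_fun (d : D) : (kerk * Dbar)%type := (j_kerk d, pbar d).

Lemma jp_zmod : zmod_morphism jp_fun.
Proof. by move=> x y; rewrite /jp_fun !raddfB. Qed.
HB.instance Definition _ :=
  GRing.isZmodMorphism.Build D (kerk * Dbar)%type jp_fun jp_zmod.

Definition jp : {additive D -> (kerk * Dbar)%type} := jp_fun.

Definition up_to_torsion (r : nat) : Prop :=
  kerg (iterg i r.+1) =i kerg (iterg i r).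

(* phi sends the class of z to the class of z, and psi is its inverse.  When
   such a pair exists it is unique. *)
Definition canonical_iso (r : nat)
    (phi : {additive page_succ r -> page_inf})
    (psi : {additive page_inf -> page_succ r}) : Prop :=
  [/\ forall (z : subg (ecZ r)) (z' : subg ecZinf), val z = val z' ->
        phi (subquot_pi (ecZ r) (ecB r) z) = subquot_pi ecZinf ecBinf z',
      cancel phi psi & cancel psi phi].

Section LastMap.
Variables (r : nat) (psi : {additive page_inf -> page_succ r}).

Definition kerk_to_page : {additive kerk -> page_succ r} :=
  psi \o (kerk_quot_to_inf \o kerk_pi).

Definition Dbar_to_page : {additive Dbar -> page_succ r} :=
  psi \o (kerk_quot_to_inf \o jbar).

Definition diff_to_page (x : kerk * Dbar) : page_succ r :=
  psi (kerk_quot_to_inf (kerk_pi x.1 - jbar x.2)).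

End LastMap.

End ExactCouple.

(* Main.v *)
Require Import Defs.
From HB Require Import structures.
From mathcomp Require Import all_boot all_order all_algebra.
From mathcomp Require Import boolp.

(** The two pages [E_(r+1)] and [E_oo] are subquotients of the same group [E],
    and both sit over [ker k / j (ker i^oo)].  The inclusions
    [ker k <= Z_oo <= Z_r] and [B_r <= j (ker i^oo) <= B_oo] always hold, and
    up to [i^r]-torsion all of them are equalities.  Indeed the kernels of the
    powers of [i] are then constant from [ker i^r] on
    ([ker_inf_sub_kerg]), which handles the boundaries ([ecBinf_sub_ecB]); and
    if [k e = i^r y], then [i^(r+1) y = i (k e) = 0], hence [k e = i^r y = 0],
    which handles the cycles ([ecZ_sub_kerk]).  Mutually inverse isomorphisms
    of subquotients are then induced by the inclusions ([subquot_mapK]).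

    The four-term sequence is, torsion or not, exact with
    [ker k / j (ker i^oo)] as its last term.  On the left, [(j, p)] vanishes on
    [d] exactly when [d] lies in [Im i = ker j] and in [ker i^oo = ker p]
    ([jp_eq0]).  In the middle, if [x] in [ker k] and [p d] have the same image,
    then [x = j d + j t] with [t] in [ker i^oo], so that [(x, p d)] is the image
    of [d + t] ([kerk_pi_eq_jbar]).

    When [r = 1], the left-hand term is zero, since [i y] in [ker i^oo] forces
    [i^2 y = 0] and so [i y = 0] ([jp_inj]); exactness then identifies [D] with
    the fibre product, and the universal property follows formally
    ([cartesian_of_exact]).  Conversely, if [i^(r+1) x = 0] then [i x] lies in
    [Im i] and in [ker i^oo], that is in the kernel of [(j, p)]; when this
    kernel is killed by [i^(r-1)] one gets [i^r x = 0]. *)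

Set Implicit Arguments.
Unset Strict Implicit.
Unset Printing Implicit Defensive.

Import GRing.Theory.
Local Open Scope ring_scope.

(** * Subquotients and fibre products *)

Lemma subquot_mapK (V : zmodType) (A A' B B' : zmodClosed V)
    (sA : {subset A <= A'}) (sB : {subset B <= B'})
    (sA' : {subset A' <= A}) (sB' : {subset B' <= B}) :
  cancel (subquot_map sA sB) (subquot_map sA' sB').
Proof.
move=> q; have [x <-] := subquot_pi_surj q; rewrite !subquot_mapE.
by apply/subquot_piP; rewrite /= subrr rpred0.
Qed.

(** A fibre product is a subgroup of a product, so a square is Cartesian as
    soon as the pair of maps out of its corner is injective with the expected
    image: the map into [X] is then obtained by choosing preimages, and
    injectivity makes the choice additive. *)
Lemma cartesian_of_exact (X U V W : zmodType)
    (f : {additive X -> U}) (g : {additive X -> V})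
    (u : {additive U -> W}) (v : {additive V -> W}) :
  (forall x, f x = 0 -> g x = 0 -> x = 0) ->
  (forall a b, u a = v b <-> exists x, f x = a /\ g x = b) ->
  cartesian f g u v.
Proof.
move=> fg0 uvP.
have fg_inj x y : f x = f y -> g x = g y -> x = y.
  by move=> fxy gxy; apply/subr0_eq/fg0; rewrite raddfB ?fxy ?gxy subrr.
split=> [x|T a b ab]; first by apply/uvP; exists x.
split; last first.
  move=> h h' hab h'ab t; have [fh gh] := hab t; have [fh' gh'] := h'ab t.
  by apply: fg_inj; rewrite ?fh ?gh.
have /choice[h hP] : forall t, exists x, f x = a t /\ g x = b t.
  by move=> t; apply/uvP.
have h_zmod : zmod_morphism h.
  move=> s t; have [fs gs] := hP s; have [ft gt] := hP t.
  have [fst gst] := hP (s - t).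
  by apply: fg_inj; rewrite raddfB ?fst ?gst raddfB ?fs ?ft ?gs ?gt.
pose hM := GRing.isZmodMorphism.Build T X h h_zmod.
pose ha : {additive T -> X} := HB.pack h hM.
by exists ha; split=> t; have [] := hP t.
Qed.

Section ExactCoupleTheory.
Variable C : exact_couple.
Local Notation D := (ecD C).
Local Notation i := (eci C).
Local Notation j := (ecj C).
Local Notation k := (eck C).

(** * The exact sequence without torsion hypothesis *)

Lemma itergSr n d : iterg i n.+1 d = iterg i n (i d).
Proof. exact: iterSr. Qed.

Lemma ker_infP d : reflect (exists n, iterg i n d = 0) (d \in ker_inf i).
Proof.
by apply: (iffP (asboolP _)) => -[n nd]; exists n; apply/eqP.
Qed.

Lemma pbar_eq0 d : pbar C d = 0 <-> d \in ker_inf i.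
Proof.
split=> [/(congr1 val) /= pd|/ker_infP[n nd]].
  have /tel_inP[N] : tel_in i 0 d = tel_in i 0 0 by [].
  by rewrite addn0 raddf0 => eN; apply/ker_infP; exists N.
apply: val_inj => /=; apply/tel_inP; exists n.
by rewrite addn0 nd raddf0.
Qed.

Lemma j_kerk_eq0 d : j_kerk C d = 0 <-> d \in ecDn C 1.
Proof.
split=> [/(congr1 val) /= jd|/asboolP[x xd]].
  by have [/(_ jd) [x xd] _] := ec_exact_ij d; apply/asboolP; exists x.
by apply: val_inj => /=; apply/ec_exact_ij; exists x.
Qed.

Lemma jp_eq0 d : jp C d = 0 <-> d \in capg (ecDn C 1) (ker_inf i).
Proof.
rewrite inE; split=> [[jd pd]|/andP[/j_kerk_eq0 jd /pbar_eq0 pd]].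
  by apply/andP; split; [apply/j_kerk_eq0/val_inj | apply/pbar_eq0/val_inj].
by congr (_, _).
Qed.

(** A class in [j (ker i^oo)] can be absorbed in [d], because [p] does not see
    [ker i^oo]. *)
Lemma kerk_pi_eq_jbar (x : kerk C) (b : Dbar C) :
  kerk_pi C x = jbar C b <-> exists d, j_kerk C d = x /\ pbar C d = b.
Proof.
split=> [|[d [<- <-]]]; last by rewrite -[jbar C _]/(jbar_fun _) jbarE.
have [d <-] := pbar_surj b; rewrite -[jbar C _]/(jbar_fun _) jbarE.
move=> /subquot_piP /= /asboolP[t t0 jt]; exists (d + t); split.
  by apply: val_inj; rewrite /= raddfD jt addrC subrK.
by rewrite raddfD (pbar_eq0 t).2 ?addr0.
Qed.

(** * Degeneration up to torsion *)

Section UpToTorsion.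
Variable r : nat.
Hypothesis torC : up_to_torsion C r.

Lemma ker_inf_sub_kerg : {subset ker_inf i <= kerg (iterg i r)}.
Proof.
move=> d /ker_infP[n]; elim: n d => [|n IHn] d nd.
  by rewrite inE [d]nd raddf0.
(* by induction i^r kills i d, that is, i^(r+1) kills d *)
have : i d \in kerg (iterg i r) by apply: IHn; rewrite -itergSr.
by rewrite -torC !inE itergSr.
Qed.

(** Write [k e = i^r y]: exactness of [k] and [i] gives [i^(r+1) y = 0], so that
    the torsion bound already forces [k e = 0]. *)
Lemma ecZ_sub_kerk : {subset ecZ C r <= kerg k}.
Proof.
move=> e /asboolP[y ky]; have ik : i (k e) = 0 by apply/ec_exact_ki; exists e.
have : y \in kerg (iterg i r.+1).
  by rewrite inE -[iterg i r.+1 y]/(i (iterg i r y)) ky ik.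
by rewrite torC !inE ky.
Qed.

Lemma ecZinf_sub_kerk : (0 < r)%N -> {subset @ecZinf C <= kerg k}.
Proof. by move=> r_gt0 e /asboolP Ze; apply: ecZ_sub_kerk; apply: Ze. Qed.

Lemma ecZ_sub_ecZinf : {subset ecZ C r <= @ecZinf C}.
Proof. by move=> e /ecZ_sub_kerk; apply: kerk_subZinf. Qed.

Lemma ecBinf_sub_jkerinf : {subset @ecBinf C <= jkerinf C}.
Proof.
move=> e /asboolP[n _ /asboolP[y ny <-]].
by apply/asboolP; exists y => //; apply/asboolP; exists n.
Qed.

Lemma ecBinf_sub_ecB : {subset @ecBinf C <= ecB C r}.
Proof.
move=> e /ecBinf_sub_jkerinf /asboolP[y /ker_inf_sub_kerg y0 <-].
by apply/asboolP; exists y.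
Qed.

Lemma ecB_sub_ecBinf : (0 < r)%N -> {subset ecB C r <= @ecBinf C}.
Proof. by move=> r_gt0 e Be; apply/asboolP; exists r. Qed.

Lemma ecZinf_sub_ecZ : (0 < r)%N -> {subset @ecZinf C <= ecZ C r}.
Proof. by move=> r_gt0 e /asboolP; apply. Qed.

Lemma kerk_quot_to_inf_bij : (0 < r)%N -> bijective (kerk_quot_to_inf C).
Proof.
move=> r_gt0.
by exists (subquot_map (ecZinf_sub_kerk r_gt0) ecBinf_sub_jkerinf);
  exact: subquot_mapK.
Qed.

Lemma degeneration : (0 < r)%N ->
  exists (phi : {additive page_succ C r -> page_inf C})
         (psi : {additive page_inf C -> page_succ C r}), canonical_iso phi psi.
Proof.
move=> r_gt0.
exists (subquot_map ecZ_sub_ecZinf (ecB_sub_ecBinf r_gt0)).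
exists (subquot_map (ecZinf_sub_ecZ r_gt0) ecBinf_sub_ecB).
split; [|exact: subquot_mapK..].
move=> z z' zz'; rewrite subquot_mapE; apply/subquot_piP.
by rewrite /= -[sval z]/(val z) zz' subrr rpred0.
Qed.

End UpToTorsion.

(** An element [i y] of [ker i^oo] is killed by [i], so [y] is killed by [i^2],
    hence by [i]. *)
Lemma jp_inj d : up_to_torsion C 1 -> jp C d = 0 -> d = 0.
Proof.
move=> torC /jp_eq0; rewrite inE => /andP[/asboolP[y <-]].
move=> /(ker_inf_sub_kerg torC) iiy.
have : y \in kerg (iterg i 2) by exact: iiy.
by rewrite torC => /eqP.
Qed.

(** * The map onto the page of degeneration *)

Section LastMapTheory.
Variables (r : nat) (psi : {additive page_inf C -> page_succ C r}).
Hypotheses (inf_bij : bijective (kerk_quot_to_inf C)) (psi_bij : bijective psi).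

(** Both maps factor through [ker k / j (ker i^oo)], which embeds in the page;
    so equality can be tested there, where [kerk_pi_eq_jbar] decides it. *)
Lemma to_page_eq (x : kerk C) (b : Dbar C) :
  kerk_to_page psi x = Dbar_to_page psi b <->
  exists d, j_kerk C d = x /\ pbar C d = b.
Proof.
rewrite -kerk_pi_eq_jbar; split=> [|/= -> //].
by move=> /(bij_inj psi_bij) /(bij_inj inf_bij).
Qed.

Lemma diff_to_pageE (x : kerk C * Dbar C) :
  diff_to_page psi x = kerk_to_page psi x.1 - Dbar_to_page psi x.2.
Proof. by rewrite /diff_to_page !raddfB. Qed.

Lemma exact_jp_diff : exact_at (jp C) (diff_to_page psi).
Proof.
move=> [x b]; rewrite diff_to_pageE; split=> [/subr0_eq/to_page_eq[d [jd pd]]|].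
  by exists d; congr (_, _).
by move=> [d [<- <-]]; apply/eqP; rewrite subr_eq0; apply/eqP/to_page_eq; exists d.
Qed.

Lemma diff_to_page_surj e : exists x, diff_to_page psi x = e.
Proof.
have [psi' _ psi'K] := psi_bij; have [inv _ invK] := inf_bij.
have [x xE] := subquot_pi_surj (inv (psi' e)); exists (x, 0).
by rewrite diff_to_pageE raddf0 subr0 /= /kerk_pi xE invK psi'K.
Qed.

End LastMapTheory.

End ExactCoupleTheory.

Theorem proposition5 (C : exact_couple) :
  (forall r : nat, (1 <= r)%N -> up_to_torsion C r ->
    exists (phi : {additive page_succ C r -> page_inf C})
           (psi : {additive page_inf C -> page_succ C r}),
      [/\ canonical_iso phi psi,
          bijective (kerk_quot_to_inf C) &
          [/\ injective (subg_val (capg (ecDn C 1) (ker_inf (eci C)))),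
              exact_at (subg_val (capg (ecDn C 1) (ker_inf (eci C)))) (jp C),
              exact_at (jp C) (diff_to_page psi) &
              forall e : page_succ C r, exists x, diff_to_page psi x = e]])
  /\
  (up_to_torsion C 1 ->
    exists (phi : {additive page_succ C 1 -> page_inf C})
           (psi : {additive page_inf C -> page_succ C 1}),
      [/\ canonical_iso phi psi,
          cartesian (j_kerk C) (pbar C) (kerk_to_page psi) (Dbar_to_page psi) &
          exists h : {additive ecD C -> fibre_prod (kerk_to_page psi) (Dbar_to_page psi)},
            bijective h /\ forall d, subg_val _ (h d) = jp C d])
  /\
  (forall r : nat, (1 <= r)%N ->
    kerg (jp C) =i capg (ecDn C 1) (kerg (iterg (eci C) r.-1)) ->
    up_to_torsion C r).
Proof.
split; [|split].
- move=> r r_gt0 torC; have [phi [psi iso]] := degeneration torC r_gt0.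
  exists phi, psi; have inf_bij := kerk_quot_to_inf_bij torC r_gt0.
  have psi_bij : bijective psi by case: iso => _ phiK psiK; exists phi.
  split=> //; split; [exact: val_inj| |exact: exact_jp_diff|exact: diff_to_page_surj].
  move=> d; rewrite jp_eq0; split=> [dcap|[x <-]]; last exact: valP x.
  by exists (exist _ d dcap).
- move=> torC; have [phi [psi iso]] := degeneration torC (ltn0Sn 0).
  exists phi, psi; have inf_bij := kerk_quot_to_inf_bij torC (ltn0Sn 0).
  have psi_bij : bijective psi by case: iso => _ phiK psiK; exists phi.
  have toP := to_page_eq inf_bij psi_bij.
  split=> //.
    apply: cartesian_of_exact => [d jd pd|]; last exact: toP.
    by apply: jp_inj torC _; rewrite -[jp C d]/(j_kerk C d, pbar C d) jd pd.
  have jp_fib d : jp C d \in fibre_prod_pred (kerk_to_page psi) (Dbar_to_page psi).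
    by rewrite inE; apply/eqP/toP; exists d.
  exists (corestr jp_fib); split=> //.
  have h_inj : injective (corestr jp_fib).
    move=> d d' /(congr1 val) /= jpd; apply/subr0_eq/(jp_inj torC).
    by rewrite raddfB -[jp C d]/(jp_fun d) jpd subrr.
  have h_surj y : exists d, corestr jp_fib d = y.
    case: y => [[x b] xb]; have /eqP/toP[d [jd pd]] := xb.
    by exists d; apply: val_inj; congr (_, _).
  have [g gP] := choice h_surj.
  by exists g => // d; apply: h_inj; rewrite gP.
- move=> r r_gt0 kerE x; apply/idP/idP; rewrite !inE => /eqP xr; last first.
    by rewrite -[iterg _ _ _]/(eci C (iterg (eci C) r x)) xr raddf0.
  have : eci C x \in kerg (jp C).
    apply/eqP/jp_eq0; rewrite inE; apply/andP; split; first by apply/asboolP; exists x.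
    by apply/ker_infP; exists r; rewrite -itergSr.
  rewrite kerE inE => /andP[_]; rewrite inE -itergSr prednK // => /eqP.
Qed.
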